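(* For every $n\ge 1$, the restriction of $\sigma$ to the set $P_n$ of Pell permutations is a bijection $\sigma:P_n\to\Sigma_{n-1}$ whose inverse is $\eta:\Sigma_{n-1}\to P_n$.
   Context: $S_n$ is the set of permutations of $[n]=\{1,\dots,n\}$ in one-line notation. A Pell permutation is $x=x_1\cdots x_n\in S_n$ such that $x_i-x_{i+1}\le 2$ for all $i$, and whenever $x_i=x_{i+1}+2$ the value $x_{i+1}+1$ appears to the right of $x_{i+1}$. $P_n$ is the set of Pell permutations in $S_n$. A sash of length $m\ge 0$ is a tiling of a $1\times m$ rectangle by black $1\times1$ squares, white $1\times1$ squares and white $1\times2$ rectangles; $\Sigma_m$ is the set of sashes of length $m$ (there is a single sash of length $0$). Positions are numbered $1,\dots,m$ from left to right; a rectangle occupies two consecutive positions (its left half and its right half). Definition of $\sigma:S_n\to\Sigma_{n-1}$: for $x\in S_n$, if $i+1$ is to the right of $i$ in $x$ then position $i$ of $\sigma(x)$ is a black square, and if $i+1$ is to the left of $i$ then position $i$ is a white square ($1\le i\le n-1$), with one exception: if $i+1$ is to the right of $i$ and $i+2$ is to the left of $i$, then a rectangle occupies positions $i$ and $i+1$. (For $n=1$, $\sigma(1)$ is the sash of length $0$.) Definition of $\eta:\Sigma_{n-1}\to P_n$: start with the one-entry word $1$; for $i=1,\dots,n-1$, if position $i$ of $A$ is a black square or the left half of a rectangle, place $i+1$ at the right end of the word; if position $i$ is a white square, place $i+1$ immediately to the left of $i$; if position $i$ is the right half of a rectangle, place $i+1$ immediately to the left of $i-1$. The resulting word is $\eta(A)$,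 and it is a Pell permutation. *)

(* Defs.v *)
From mathcomp Require Import all_boot.
From mathcomp Require Import boolp classical_sets functions.

Set Implicit Arguments.
Unset Strict Implicit.
Unset Printing Implicit Defensive.

Local Open Scope classical_set_scope.

(* Permutations of {1, ..., n} are words in one-line notation. *)
Definition permutations_of (n : nat) : set (seq nat) :=
  [set x | perm_eq x (iota 1 n)].

(* The entry x_i, numbered from 1. *)
Definition entry (x : seq nat) (i : nat) : nat := nth 0 x i.-1.

(* b is to the right of a in x, for letters a and b that occur in x. *)
Definition right_of (x : seq nat) (b a : nat) : bool := index a x < index b x.
Definition left_of (x : seq nat) (b a : nat) : bool := index b x < index a x.

(* Truncated subtraction is harmless in x_i - x_{i+1} <= 2. *)
Definition Pell (n : nat) : set (seq nat) :=
  [set x | permutations_of n x /\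
    forall i, 1 <= i < n ->
      entry x i - entry x i.+1 <= 2 /\
      (entry x i = entry x i.+1 + 2 ->
       right_of x (entry x i.+1 + 1) (entry x i.+1))].

Inductive tile := BlackSquare | WhiteSquare | WhiteRectangle.

Definition tile_width (t : tile) : nat :=
  if t is WhiteRectangle then 2 else 1.

Definition Sash (m : nat) : set (seq tile) :=
  [set A | sumn (map tile_width A) = m].

(* Tiles the positions i, ..., i + m - 1.  When a rectangle is placed at i, *)
(* position i + 1 is covered and cannot start a rectangle itself: i + 2 is  *)
(* then to the left of i + 1.  There is no rectangle at the last position.  *)
Fixpoint sigma_from (x : seq nat) (i m : nat) {struct m} : seq tile :=
  let square := if right_of x i.+1 i then BlackSquare else WhiteSquare in
  match m with
  | 0 => [::]
  | 1 => [:: square]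
  | (k.+1 as m').+1 =>
      if right_of x i.+1 i && left_of x i.+2 i
      then WhiteRectangle :: sigma_from x i.+2 k
      else square :: sigma_from x i.+1 m'
  end.

Definition sigma (n : nat) (x : seq nat) : seq tile := sigma_from x 1 n.-1.

Inductive cell := Black | White | LeftHalf | RightHalf.

Definition tile_cells (t : tile) : seq cell :=
  match t with
  | BlackSquare => [:: Black]
  | WhiteSquare => [:: White]
  | WhiteRectangle => [:: LeftHalf; RightHalf]
  end.

Definition cells (A : seq tile) : seq cell := flatten (map tile_cells A).

Definition insert_left_of (b a : nat) (w : seq nat) : seq nat :=
  take (index a w) w ++ b :: drop (index a w) w.

Definition eta_step (i : nat) (c : cell) (w : seq nat) : seq nat :=
  match c with
  | Black | LeftHalf => rcons w i.+1
  | White => insert_left_of i.+1 i w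
  | RightHalf => insert_left_of i.+1 i.-1 w
  end.

(* cs lists the cells at positions i, i + 1, ... *)
Fixpoint eta_from (i : nat) (w : seq nat) (cs : seq cell) : seq nat :=
  if cs is c :: cs' then eta_from i.+1 (eta_step i c w) cs' else w.

Definition eta (A : seq tile) : seq nat := eta_from 1 [:: 1] (cells A).

(* Main.v *)
Require Import Defs.
From mathcomp Require Import all_boot.
From mathcomp Require Import boolp classical_sets functions.
From mathcomp Require Import zify.

(** A word on 1, ..., n + 1 is a word on 1, ..., n into which n + 1 is inserted,
    and inserting a letter does not change the relative order of the others.
    Both halves of the proof rest on this.

    The tests made by sigma compare letters i, i + 1, i + 2, whose relative
    order is settled when eta inserts them ([right_of_eta_from]).  Hence sigma
    reads off from the word of A the tiles of A ([sigma_from_eta_from]).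

    Inserting n + 1 in a permutation gives a Pell permutation exactly when the
    old permutation is Pell and n + 1 is put at the end, immediately left of n,
    or immediately left of n - 1 when n is to the right of n - 1
    ([Pell_insert_max]).  These are the moves that eta makes for a black square,
    a white square and the right half of a rectangle, so eta takes values in
    Pell permutations ([Pell_eta_from]).  Conversely, deleting the largest
    letter shows by induction that every Pell permutation is of the form eta A
    ([eta_surj]).

    Since sigma (eta A) = A and eta is onto, the two maps are inverse
    bijections. *)

Set Implicit Arguments.
Unset Strict Implicit.
Unset Printing Implicit Defensive.

Local Notation width A := (sumn (map tile_width A)).

(** * Words and the order of their letters *)
Lemma mem_permutation n w k :
  permutations_of n w -> (k \in w) = (0 < k <= n).
Proof. by move=> /perm_mem->; rewrite mem_iota add1n ltnS. Qed.

Lemma uniq_permutation n w : permutations_of n w -> uniq w.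
Proof. by move=> /perm_uniq->; apply: iota_uniq. Qed.

Lemma permutation_insert_max n s1 s2 :
  permutations_of n.+1 (s1 ++ n.+1 :: s2) <-> permutations_of n (s1 ++ s2).
Proof.
have iota_rcons : iota 1 n.+1 = rcons (iota 1 n) n.+1.
  by rewrite -cats1 -{1}[n.+1]addn1 iotaD.
rewrite /permutations_of iota_rcons /= perm_sym perm_rcons perm_sym.
by rewrite -cat1s perm_catCA perm_cons.
Qed.

Lemma right_of_insert s1 s2 (m a b : nat) : m != a -> m != b ->
  right_of (s1 ++ m :: s2) b a = right_of (s1 ++ s2) b a.
Proof.
rewrite /right_of => ma mb.
elim: s1 => [|c s1 IH] /=; first by rewrite (negPf ma) (negPf mb).
by case: (c == a); case: (c == b); rewrite ?ltnS.
Qed.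

Lemma right_ofN x a b : a \in x -> a != b ->
  right_of x b a = ~~ right_of x a b.
Proof.
move=> ax ab; rewrite /right_of -leqNgt ltn_neqAle.
case: eqP => // eq_ab; case/negP: ab.
have bx : b \in x by rewrite -index_mem -eq_ab index_mem.
by apply/eqP; apply: (index_inj a ax bx eq_ab).
Qed.

Lemma right_of_rcons w (m a : nat) :
  m \notin w -> a \in w -> right_of (rcons w m) m a.
Proof.
move=> mw aw; rewrite /right_of -cats1 !index_cat aw (negPf mw) /= eqxx addn0.
by rewrite index_mem.
Qed.

Lemma insert_left_of_head s1 s2 (a m : nat) : a \notin s1 ->
  insert_left_of m a (s1 ++ a :: s2) = s1 ++ m :: a :: s2.
Proof.
move=> as1; rewrite /insert_left_of index_cat (negPf as1) /= eqxx addn0.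
by rewrite take_size_cat // drop_size_cat.
Qed.

Lemma insert_left_of_split w (a : nat) : a \in w ->
  exists s1 s2, w = s1 ++ a :: s2 /\
    forall m, insert_left_of m a w = s1 ++ m :: a :: s2.
Proof.
move=> aw; exists (take (index a w) w), (drop (index a w).+1 w).
by rewrite /insert_left_of -drop_index // cat_take_drop.
Qed.

(** The letter m lands immediately left of a, so every other letter compares
    with m as it did with a. *)
Lemma right_of_inserted w (m a c : nat) :
  m \notin w -> a \in w -> c \in w ->
  right_of (insert_left_of m a w) m c = right_of w a c.
Proof.
move=> mw aw cw; rewrite /right_of /insert_left_of.
have mt : m \notin take (index a w) w by apply: contra mw; apply: mem_take.
rewrite [index m _]index_cat (negPf mt) /= eqxx addn0.
rewrite size_take index_mem aw -[RHS](in_take _ cw) index_cat.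
case: ifP => ct; first by rewrite -index_mem size_take index_mem aw in ct.
by rewrite size_take index_mem aw -ltn_subRL subnn ltn0.
Qed.

(** * The words built by eta *)
Lemma eta_step_insert i c w :
  exists s1 s2, w = s1 ++ s2 /\ eta_step i c w = s1 ++ i.+1 :: s2.
Proof.
have ins a : exists s1 s2, w = s1 ++ s2 /\
    insert_left_of i.+1 a w = s1 ++ i.+1 :: s2.
  by exists (take (index a w) w), (drop (index a w) w); rewrite cat_take_drop.
have end_ : exists s1 s2, w = s1 ++ s2 /\ rcons w i.+1 = s1 ++ i.+1 :: s2.
  by exists w, [::]; rewrite cats0 cats1.
by case: c => /=.
Qed.

Lemma permutation_eta_step i c w :
  permutations_of i w -> permutations_of i.+1 (eta_step i c w).
Proof.
have [s1 [s2 [-> ->]]] := eta_step_insert i c w.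
by move/permutation_insert_max.
Qed.

(** Later insertions never reorder letters already present, so a test made by
    sigma on the final word can be evaluated on the word at the stage where the
    last of the letters involved is placed. *)
Lemma right_of_eta_from cs i w a b : a <= i -> b <= i ->
  right_of (eta_from i w cs) b a = right_of w b a.
Proof.
elim: cs i w => //= c cs IH i w ai bi; rewrite IH; [|lia|lia].
have [s1 [s2 [-> ->]]] := eta_step_insert i c w.
by apply: right_of_insert; lia.
Qed.

Lemma eta_from_cat cs1 cs2 i w :
  eta_from i w (cs1 ++ cs2) =
  eta_from (i + size cs1) (eta_from i w cs1) cs2.
Proof.
by elim: cs1 i w => [|c cs1 IH] i w /=; rewrite ?addn0 ?addnS -?addSn // IH.
Qed.

Lemma size_cells A : size (cells A) = width A.
Proof.
by rewrite size_flatten /shape -map_comp; congr sumn; apply: eq_map => -[].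
Qed.

Lemma eta_rcons A t :
  eta (rcons A t) = eta_from (width A).+1 (eta A) (tile_cells t).
Proof.
rewrite /eta /cells map_rcons flatten_rcons eta_from_cat add1n.
by rewrite -/(cells A) size_cells.
Qed.

Lemma permutation_eta_from cs i w :
  permutations_of i w -> permutations_of (i + size cs) (eta_from i w cs).
Proof.
elim: cs i w => [|c cs IH] i w pw /=; first by rewrite addn0.
by rewrite addnS -addSn; apply/IH/permutation_eta_step.
Qed.

Lemma permutation_eta A : permutations_of (width A).+1 (eta A).
Proof. by rewrite -size_cells -add1n; apply: permutation_eta_from. Qed.

(** * sigma recovers the sash *)
Lemma sigma_fromSS x i m :
  sigma_from x i m.+2 =
  if right_of x i.+1 i && left_of x i.+2 i
  then WhiteRectangle :: sigma_from x i.+2 m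
  else (if right_of x i.+1 i then BlackSquare else WhiteSquare)
         :: sigma_from x i.+1 m.+1.
Proof. by []. Qed.

(** Reading the sash from the left, each tile is visible in the word as soon as
    its letters are inserted.  A black square additionally must not be mistaken
    for the start of a rectangle, which depends on where the next letter
    goes. *)
Lemma sigma_from_eta_from A i w : 0 < i -> permutations_of i w ->
  sigma_from (eta_from i w (cells A)) i (width A) = A.
Proof.
elim: A i w => [|t A IH] i w i0 pw //.
have memw k := mem_permutation k pw.
have iw : i \in w by rewrite memw i0 leqnn.
have ni1 : i.+1 \notin w by rewrite memw; lia.
case: t.
- rewrite [eta_from _ _ _]/=.
  have -> : width (BlackSquare :: A) = (width A).+1 by [].
  set w1 := rcons w i.+1.
  have pw1 : permutations_of i.+1 w1 by apply: (permutation_eta_step Black).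
  have memw1 k := mem_permutation k pw1.
  have r1 : right_of w1 i.+1 i by apply: right_of_rcons.
  have := IH i.+1 w1 isT pw1.
  set x := eta_from _ _ _ => IHx.
  have rx : right_of x i.+1 i by rewrite /x right_of_eta_from; lia.
  case Em: (sumn _) IHx => [|m] IHx; first by rewrite /= rx -IHx.
  suff nl : left_of x i.+2 i = false by rewrite sigma_fromSS rx nl IHx.
  have i1w : i.+1 \in w1 by rewrite memw1; lia.
  have iw1 : i \in w1 by rewrite memw1; lia.
  have ni2 : i.+2 \notin w1 by rewrite memw1; lia.
  have ix : i \in x.
    by rewrite (mem_permutation i (permutation_eta_from (cells A) pw1)); lia.
  apply/negbTE; rewrite -[left_of x _ _]/(right_of x i i.+2) -right_ofN //;
    last by lia.
  (* No tile starts with a right half, so i + 2 goes to the end or left of    *)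
  (* i + 1, in both cases to the right of i.                                  *)
  rewrite /x; have [c [cs [-> cR]]] :
      exists c cs, cells A = c :: cs /\ c <> RightHalf.
    case: A Em {IH IHx x rx ix} => [|[] A] // _;
      by do 2!eexists; split; first reflexivity.
  rewrite /= right_of_eta_from; [|lia|lia].
  by case: c cR => //= _; rewrite ?right_of_inserted ?right_of_rcons.
- rewrite [eta_from _ _ _]/=.
  have -> : width (WhiteSquare :: A) = (width A).+1 by [].
  set w1 := insert_left_of _ _ _.
  have pw1 : permutations_of i.+1 w1 by apply: (permutation_eta_step White).
  have := IH i.+1 w1 isT pw1.
  set x := eta_from _ _ _ => IHx.
  have rx : right_of x i.+1 i = false.
    rewrite /x right_of_eta_from; [|lia|lia].
    by rewrite right_of_inserted // /right_of ltnn.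
  case: (sumn _) IHx => [|m] IHx; first by rewrite /= rx -IHx.
  by rewrite sigma_fromSS rx IHx.
rewrite [eta_from _ _ _]/=.
have -> : width (WhiteRectangle :: A) = (width A).+2 by [].
set w1 := rcons w i.+1; set w2 := insert_left_of _ _ _.
have pw1 : permutations_of i.+1 w1 by apply: (permutation_eta_step Black).
have pw2 : permutations_of i.+2 w2 by apply: (permutation_eta_step RightHalf).
have := IH i.+2 w2 isT pw2.
set x := eta_from _ _ _ => IHx.
have iw1 : i \in w1 by rewrite (mem_permutation _ pw1); lia.
have ni2 : i.+2 \notin w1 by rewrite (mem_permutation _ pw1); lia.
have rx : right_of x i.+1 i.
  rewrite /x right_of_eta_from; [|lia|lia].
  have [s1 [s2 [ew1 ew2]]] := eta_step_insert i.+1 RightHalf w1.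
  rewrite /w2 -[insert_left_of _ _ _]/(eta_step i.+1 RightHalf w1) ew2.
  by rewrite right_of_insert -?ew1 ?right_of_rcons //; lia.
have lx : left_of x i.+2 i.
  rewrite -[left_of x _ _]/(right_of x i i.+2) /x right_of_eta_from; [|lia|lia].
  rewrite right_ofN; [|by rewrite (mem_permutation _ pw2); lia|lia].
  by rewrite right_of_inserted // /right_of ltnn.
by rewrite sigma_fromSS rx lx IHx.
Qed.

(** * Inserting the largest letter of a Pell permutation *)

(** The Pell condition on adjacent entries a, b as a boolean relation, so that
    the theory of sorted applies; the word x is kept as a separate argument
    because the position of b + 1 refers to all of it. *)
Definition pell_step (x : seq nat) (a b : nat) : bool :=
  (a <= b.+2) && ((a == b.+2) ==> right_of x b.+1 b).

Lemma PellE n x :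
  Pell n x <-> permutations_of n x /\ sorted (pell_step x) x.
Proof.
rewrite /Pell /=; split=> -[px Hx]; split=> //; have := perm_size px.
  rewrite size_iota => sx; apply/(sortedP 0) => i; rewrite sx => lin.
  have [le2 r] := Hx i.+1 lin; rewrite /entry /= in le2 r.
  apply/andP; split; first lia.
  by apply/implyP => /eqP; rewrite addn2 addn1 in r.
rewrite size_iota => sx [|i] // /andP[_ lin].
have /andP[le2 /implyP r] := sortedP 0 Hx i ltac:(by rewrite sx).
rewrite /entry /=; split; first lia.
by rewrite addn2 addn1 => /eqP.
Qed.

(** The places where the new maximal letter n + 1 can be put between s1 and s2:
    at the end, before n, or before n - 1 when n is to the right of it.  These
    are the places that eta uses. *)
Definition max_fits (n : nat) (s1 s2 : seq nat) : bool :=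
  if s2 is b :: _ then (b == n) || (b.+1 == n) && right_of (s1 ++ s2) n b
  else true.

(** Only adjacencies around n + 1 change.  The ascent into n + 1 is always
    allowed, and the descent out of it to b is allowed exactly when
    b >= n - 1, with n to the right in case b = n - 1. *)
Lemma Pell_insert_max n s1 s2 :
  Pell n.+1 (s1 ++ n.+1 :: s2) <-> Pell n (s1 ++ s2) /\ max_fits n s1 s2.
Proof.
rewrite !PellE permutation_insert_max.
suff E : permutations_of n (s1 ++ s2) ->
  sorted (pell_step (s1 ++ n.+1 :: s2)) (s1 ++ n.+1 :: s2) =
  sorted (pell_step (s1 ++ s2)) (s1 ++ s2) && max_fits n s1 s2.
  split=> [[pw]|[[pw ss] g]]; first by rewrite E // => /andP[-> ->].
  by rewrite E // ss g.
move=> pw.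
have memw k := mem_permutation k pw.
have le1 : all (fun k => k <= n) s1.
  by apply/allP => k k1; have := memw k; rewrite mem_cat k1; lia.
(* If a = b + 2 with a, b <= n then b + 1 <= n as well, so the condition only *)
(* compares letters that the insertion leaves in the same order.              *)
set e := pell_step (s1 ++ s2); set e' := pell_step _.
have ee' : {in (fun k => k <= n) &, e' =2 e}.
  move=> a b; rewrite !unfold_in /= => an bn; rewrite /e' /e /pell_step.
  by case: eqP => // eab; rewrite right_of_insert //; lia.
have toN a : a <= n -> e' a n.+1.
  by move=> an; apply/andP; split; [lia|apply/implyP => /eqP; lia].
case: s2 => [|b s2] in pw memw e e' ee' toN *.
  rewrite cats1 cats0 andbT; case: s1 => [|a s1] in le1 pw memw e e' ee' toN *.
    by [].
  rewrite /= rcons_path (eq_in_path ee' le1) toN ?andbT //.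
  by apply: (allP le1); apply: mem_last.
have le2 : all (fun k => k <= n) (b :: s2).
  by apply/allP => k k2; have := memw k; rewrite mem_cat k2 orbT; lia.
have bn : b <= n by case/andP: le2.
have b0 : 0 < b by have := memw b; rewrite mem_cat mem_head orbT; lia.
have eNb : e' n.+1 b = (b == n) || (b.+1 == n) && right_of (s1 ++ b :: s2) n b.
  rewrite /e' /pell_step eqSS [n == _]eq_sym.
  case: (eqVneq b.+1 n) => [bn1|bn1]; last by lia.
  by rewrite bn1 right_of_insert; lia.
rewrite !sorted_cat_cons /= eNb /max_fits.
case: (boolP (_ || _)) => [ok|_]; last by rewrite !andbF.
rewrite andbT /= (eq_in_path ee' le2); congr andb.
(* Removing n + 1 makes its neighbours adjacent; b >= n - 1 forbids a large   *)
(* descent there.                                                             *)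
have leb a : a <= n -> e a b.
  by move=> an; apply/andP; split; [lia|apply/implyP => /eqP; lia].
case: s1 => [|a s1] in le1 pw memw e e' ee' toN eNb ok leb *; first by [].
have ln : last a s1 <= n by apply: (allP le1); apply: mem_last.
by rewrite /= !rcons_path (eq_in_path ee' le1) toN // leb.
Qed.

(** A rectangle has to be processed as one step: its left half puts i + 1 at
    the end, which is what allows its right half to put i + 2 before i. *)
Lemma Pell_eta_from A i w : 0 < i -> Pell i w ->
  Pell (i + width A) (eta_from i w (cells A)).
Proof.
elim: A i w => [|t A IH] i w i0 Pw; first by rewrite addn0.
have [pw _] := Pw.
have iw : i \in w by rewrite (mem_permutation _ pw); lia.
have Prcons : Pell i.+1 (rcons w i.+1).
  by rewrite -cats1; apply/Pell_insert_max; rewrite cats0.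
case: t; rewrite [eta_from _ _ _]/= [sumn _]/=.
- by rewrite add1n addnS -addSn; apply: IH.
- rewrite add1n addnS -addSn; apply: IH => //.
  have [s1 [s2 [ew ->]]] := insert_left_of_split iw.
  by apply/Pell_insert_max; rewrite -ew /= eqxx.
rewrite add2n !addnS -!addSn; apply: IH => //.
have iw1 : i \in rcons w i.+1 by rewrite mem_rcons inE iw orbT.
have [s1 [s2 [ew ->]]] := insert_left_of_split iw1.
apply/Pell_insert_max; rewrite -ew; split=> //=.
by rewrite -ew eqxx right_of_rcons ?orbT // (mem_permutation _ pw); lia.
Qed.

Lemma Pell_eta A : Pell (width A).+1 (eta A).
Proof.
rewrite -add1n; apply: Pell_eta_from => //.
by apply/PellE; split=> //; rewrite /permutations_of /=.
Qed.

Lemma sigma_eta A : sigma (width A).+1 (eta A) = A.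
Proof. by apply: sigma_from_eta_from; rewrite // /permutations_of /=. Qed.

(** * Every Pell permutation comes from a sash *)

(** A white square puts the largest letter n + 2 immediately left of n + 1; a
    rectangle puts n + 1 at the end and n + 2 further to the left, before n. *)
Lemma eta_rcons_last A t n : width A + tile_width t = n.+1 ->
  right_of (eta (rcons A t)) n.+2 n.+1 -> t = BlackSquare.
Proof.
have pA := permutation_eta A.
have memA k := mem_permutation k pA.
rewrite eta_rcons; case: t => //= En.
- have {}En : width A = n by lia.
  rewrite En in memA *; rewrite right_of_inserted; try by rewrite memA; lia.
  by rewrite /right_of ltnn.
have {}En : n = (width A).+1 by lia.
rewrite -En in memA *.
have nA : n \in eta A by rewrite memA; lia.
have n1A : n.+1 \notin eta A by rewrite memA; lia.
rewrite right_of_inserted; try by rewrite mem_rcons inE memA; lia.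
by rewrite right_ofN ?right_of_rcons ?mem_rcons ?inE ?eqxx //; lia.
Qed.

(** Delete the largest letter and use induction.  Its place determines the last
    tile, except that when it precedes n - 1 the last tile found by induction,
    a black square, is absorbed into a rectangle. *)
Lemma eta_surj n x : Pell n.+1 x -> exists2 A, width A = n & eta A = x.
Proof.
elim: n x => [|n IH] x Px; have [px _] := Px.
  by exists [::] => //; rewrite /eta /=; apply/esym/perm_small_eq.
have : n.+2 \in x by rewrite (mem_permutation _ px); lia.
move=> Nx; case/path.splitPr: x / Nx Px px => s1 s2 Px px.
have [Py fit] := (Pell_insert_max _ _ _).1 Px.
have [A EA eA] := IH _ Py.
have [py _] := Py.
case: s2 => [|b s2] in Px px Py fit eA py *.
  exists (rcons A BlackSquare); first by rewrite map_rcons sumn_rcons EA addn1.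
  by rewrite eta_rcons EA eA /= cats0 cats1.
have bs1 : b \notin s1.
  by have := uniq_permutation py; rewrite cat_uniq /= => /and3P[_ /norP[]].
case/orP: fit => [/eqP Eb|/andP[/eqP Eb r]].
  exists (rcons A WhiteSquare); first by rewrite map_rcons sumn_rcons EA addn1.
  by rewrite eta_rcons EA eA /= -Eb insert_left_of_head.
have b0 : 0 < b.
  by have := mem_permutation b py; rewrite mem_cat mem_head orbT; lia.
move/succn_inj: Eb b0 => Eb; subst b.
case: n IH => [|n] // _ in EA px Px py Py eA bs1 r * => _.
(* Widening the last black square of A to a rectangle moves the new letter    *)
(* from the end of the word to its place.                                     *)
case/lastP: A => [|A t] // in EA eA *.
have Et : t = BlackSquare.
  apply: (@eta_rcons_last A t n); last by rewrite eA.
  by rewrite -EA map_rcons sumn_rcons.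
rewrite {}Et map_rcons sumn_rcons /= addn1 in EA eA.
exists (rcons A WhiteRectangle); first by rewrite map_rcons sumn_rcons /=; lia.
case: EA => EA.
rewrite eta_rcons EA /=; rewrite eta_rcons EA /= in eA.
by rewrite eA insert_left_of_head.
Qed.

(** * The bijection *)

Theorem theorem2p7 : forall n : nat, 1 <= n ->
  set_bij (Pell n) (Sash n.-1) (sigma n) /\
  set_fun (Sash n.-1) (Pell n) eta /\
  (forall x : seq nat, Pell n x -> eta (sigma n x) = x) /\
  (forall A : seq tile, Sash n.-1 A -> sigma n (eta A) = A).
Proof.
case=> // n _ /=.
have sigmaK A : Sash n A -> sigma n.+1 (eta A) = A.
  by move=> <-; apply: sigma_eta.
have etaP A : Sash n A -> Pell n.+1 (eta A) by move=> <-; apply: Pell_eta.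
have etaK x : Pell n.+1 x -> Sash n (sigma n.+1 x) /\ eta (sigma n.+1 x) = x.
  by case/eta_surj=> A SA <-; rewrite sigmaK.
split; last by split=> //; split=> // x /etaK[].
split.
- by move=> x /etaK[].
- move=> x y; rewrite !inE => /etaK[_ Ex] /etaK[_ Ey] Exy.
  by rewrite -Ex Exy.
- by move=> A SA; exists (eta A); [apply: etaP|apply: sigmaK].
Qed.
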